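(* Let $m,k\ge1$, $f\in\mathbb{Q}^m\setminus\mathbb{Z}^m$, $r^1,\dots,r^k\in\mathbb{Q}^m\setminus\{0\}$, assume $X=\{(x,s)\in\mathbb{Z}^m\times\mathbb{R}^k_+ : x=f+\sum_j r^js_j\}\neq\emptyset$, and let $P=\{(x,s)\in\mathbb{R}^m\times\mathbb{R}^k_+ : x=f+\sum_j r^js_j\}$. Let $L$ be a rational lattice-free polytope in $\mathbb{R}^m$ containing $f$ in its interior. If $L$ has the 2-hyperplane property, then the $L$-cut $\sum_j\psi(r^j)s_j\ge1$ has finite split rank with respect to $P$.
   Context: Lattice-free: no integer point in the interior. $\psi(r)=\inf\{t>0: r/t\in L-f\}$. A split is $(\pi,\pi_0)$, $\pi\in\mathbb{Z}^m$, $\pi_0\in\mathbb{Z}$, acting on $x$, with boundary hyperplanes $\{\pi x=\pi_0\}$, $\{\pi x=\pi_0+1\}$. For a polyhedron $Q$, $Q(\pi,\pi_0)=\mathrm{conv}((Q\cap\{\pi x\le\pi_0\})\cup(Q\cap\{\pi x\ge\pi_0+1\}))$; split closure = intersection of all $Q(\pi,\pi_0)$; rank-$t$ split closure iteratively (rank 0 is $Q$). Split rank of a valid inequality w.r.t. $Q$: least $t$ such that it is valid for the rank-$t$ split closure, or $+\infty$. A set of points is 2-partitionable if it has at most one element or can be partitioned into two nonempty sets lying respectively on the two boundary hyperplanes of some split. $L_I$ is the convex hull of integer points of $L$; $L$ has the 2-hyperplane property if every face of $L_I$ not contained in a facet of $L$ has a 2-partitionable set of integer points. *)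

(* Defs.v *)
From HB Require Import structures.
From mathcomp Require Import all_boot all_order all_algebra.
From mathcomp Require Import boolp classical_sets reals.
Set Implicit Arguments. Unset Strict Implicit. Unset Printing Implicit Defensive.
Import Order.TTheory GRing.Theory Num.Theory.
Local Open Scope ring_scope.
Local Open Scope classical_set_scope.

Section Defs.
Variable R : realType.

Definition conv (V : lmodType R) (S : set V) : set V :=
  [set x | exists (n : nat) (l : 'I_n -> R) (p : 'I_n -> V),
     (forall i, S (p i)) /\ (forall i, 0 <= l i) /\ \sum_i l i = 1 /\
     x = \sum_i l i *: p i].

Variable m : nat.

Definition dotr (a x : 'rV[R]_m) : R := \sum_i a 0 i * x 0 i.
Definition dotz (pi : 'I_m -> int) (x : 'rV[R]_m) : R := \sum_i (pi i)%:~R * x 0 i.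

Definition int_vec (x : 'rV[R]_m) : Prop := forall i, exists z : int, x 0 i = z%:~R.
Definition rat_vec (x : 'rV[R]_m) : Prop := forall i, exists q : rat, x 0 i = ratr q.

(* topological interior (product topology = sup-norm balls) *)
Definition interior_pt (L : set 'rV[R]_m) (x : 'rV[R]_m) : Prop :=
  exists2 e : R, 0 < e &
    forall y : 'rV[R]_m, (forall i, `|y 0 i - x 0 i| < e) -> L y.

Definition lattice_free (L : set 'rV[R]_m) : Prop :=
  forall x, int_vec x -> ~ interior_pt L x.

Definition rational_polytope (L : set 'rV[R]_m) : Prop :=
  exists (n : nat) (v : 'I_n -> 'rV[R]_m),
    (forall i, rat_vec (v i)) /\ L = conv [set x | exists i, x = v i].

Definition psi (L : set 'rV[R]_m) (f r : 'rV[R]_m) : R :=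
  inf [set t : R | 0 < t /\ L (f + t^-1 *: r)].

Definition face (C F : set 'rV[R]_m) : Prop :=
  exists (a : 'rV[R]_m) (b : R),
    (forall x, C x -> dotr a x <= b) /\ F = C `&` [set x | dotr a x = b].

Definition aff_indep (n : nat) (p : 'I_n -> 'rV[R]_m) : Prop :=
  forall l : 'I_n -> R, \sum_i l i = 0 -> \sum_i l i *: p i = 0 ->
    forall i, l i = 0.

Definition dim_ge (S : set 'rV[R]_m) (d : nat) : Prop :=
  exists p : 'I_d.+1 -> 'rV[R]_m, (forall i, S (p i)) /\ aff_indep p.

Definition facet (C F : set 'rV[R]_m) : Prop :=
  face C F /\ exists d : nat,
    dim_ge C d.+1 /\ ~ dim_ge C d.+2 /\ dim_ge F d /\ ~ dim_ge F d.+1.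

Definition integer_hull (L : set 'rV[R]_m) : set 'rV[R]_m :=
  conv (L `&` int_vec).

Definition two_partitionable (S : set 'rV[R]_m) : Prop :=
  (forall x y, S x -> S y -> x = y) \/
  exists (pi : 'I_m -> int) (pi0 : int) (A B : set 'rV[R]_m),
    A `|` B = S /\ A `&` B = set0 /\ (exists a, A a) /\ (exists b, B b) /\
    (forall x, A x -> dotz pi x = pi0%:~R) /\
    (forall x, B x -> dotz pi x = pi0%:~R + 1).

Definition two_hyperplane_property (L : set 'rV[R]_m) : Prop :=
  forall F, face (integer_hull L) F ->
    ~ (exists G, facet L G /\ F `<=` G) ->
    two_partitionable (F `&` int_vec).

Variable k : nat.

Definition split_hull (Q : set ('rV[R]_m * 'rV[R]_k)) (pi : 'I_m -> int) (pi0 : int)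
  : set ('rV[R]_m * 'rV[R]_k) :=
  conv ((Q `&` [set p | dotz pi p.1 <= pi0%:~R]) `|`
        (Q `&` [set p | pi0%:~R + 1 <= dotz pi p.1])).

Definition split_closure (Q : set ('rV[R]_m * 'rV[R]_k)) : set ('rV[R]_m * 'rV[R]_k) :=
  [set p | forall (pi : 'I_m -> int) (pi0 : int), split_hull Q pi pi0 p].

Definition split_closure_rank (t : nat) (Q : set ('rV[R]_m * 'rV[R]_k)) :=
  iter t split_closure Q.

Definition Pset (f : 'rV[R]_m) (r : 'I_k -> 'rV[R]_m) : set ('rV[R]_m * 'rV[R]_k) :=
  [set p : 'rV[R]_m * 'rV[R]_k | (forall j, 0 <= p.2 0 j) /\ p.1 = f + \sum_j p.2 0 j *: r j].

Definition Xset (f : 'rV[R]_m) (r : 'I_k -> 'rV[R]_m) : set ('rV[R]_m * 'rV[R]_k) :=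
  [set p : 'rV[R]_m * 'rV[R]_k | int_vec p.1 /\ (forall j, 0 <= p.2 0 j) /\ p.1 = f + \sum_j p.2 0 j *: r j].

Definition finite_split_rank (Q : set ('rV[R]_m * 'rV[R]_k)) (c : 'I_k -> R) : Prop :=
  exists t : nat, forall p, split_closure_rank t Q p -> 1 <= \sum_j c j * p.2 0 j.

End Defs.

(* Main.v *)
Require Import Defs.
From HB Require Import structures.
From mathcomp Require Import all_boot all_order all_algebra.
From mathcomp Require Import boolp classical_sets reals.
From mathcomp Require Import ring lra zify.
Import Order.TTheory GRing.Theory Num.Theory.
Local Open Scope ring_scope.
Local Open Scope classical_set_scope.

(**
Put [h(x,s) = 1 - sum_j psi(r^j) s_j] and call an affine function [g] of [x]
provable if [h <= g] is valid for some rank-t split closure of [P]. Provability is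
preserved by convex combinations and by the split rule: if [g + e (pi x - pi0)]
and [g - e' (pi x - pi0 - 1)] are provable with [e, e' >= 0], so is [g]. For
every inequality [c x <= d] valid for [L], [(d - c x) / (d - c f)] is provable at
rank 0. The goal is that [0] is provable.

Let [T] be the set of affine [u] such that [- M u] is provable for all small
[M > 0]; it is a convex cone closed under the split rule.

- If [u < 0] on the integer points of [L], then [u] is in [T]: a lexicographically
  extreme point of the convex set dual to [T] cannot lie strictly between the two
  hyperplanes of a split, so it is integral, and it lies in [L].
- Let [u] be integral and nonpositive on the integer points of [L]; then [u] is in
  [T], by induction on the number of its integer zeros in [L]. If these lie in a
  proper face [c x = d] of [L], then [c] and [d] may be taken integral and the
  splits on [u] and on [c x - d + 1] suffice. Otherwise the 2-hyperplane property
  gives a split [w = pi x - pi0] with values 0 and 1 on the zeros, and [K u - w],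
  [K u + w - 1] have fewer zeros for [K] large.

The theorem is the case [u = 0].
*)

(** * Dot products and Farkas' lemma *)

Section Dot.
Variables (F : realFieldType) (m : nat).
Implicit Types a b x y : 'rV[F]_m.

Definition vdot a x : F := \sum_i a 0 i * x 0 i.

Lemma vdotC a x : vdot a x = vdot x a.
Proof. by apply: eq_bigr => i _; rewrite mulrC. Qed.

Lemma vdotDl a b x : vdot (a + b) x = vdot a x + vdot b x.
Proof. by rewrite -big_split; apply: eq_bigr => i _; rewrite mxE mulrDl. Qed.

Lemma vdotZl l a x : vdot (l *: a) x = l * vdot a x.
Proof. by rewrite mulr_sumr; apply: eq_bigr => i _; rewrite mxE mulrA. Qed.

Lemma vdotNl a x : vdot (- a) x = - vdot a x.
Proof. by rewrite -scaleN1r vdotZl mulN1r. Qed.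

Lemma vdot0l x : vdot 0 x = 0.
Proof. by rewrite -(scale0r 0) vdotZl mul0r. Qed.

Lemma vdot_suml n (A : 'I_n -> 'rV[F]_m) x :
  vdot (\sum_i A i) x = \sum_i vdot (A i) x.
Proof.
elim: n A => [|n IH] A; first by rewrite !big_ord0 vdot0l.
by rewrite !big_ord_recl vdotDl IH.
Qed.

Lemma vdotDr a x y : vdot a (x + y) = vdot a x + vdot a y.
Proof. by rewrite vdotC vdotDl !(vdotC _ a). Qed.

Lemma vdotZr l a x : vdot a (l *: x) = l * vdot a x.
Proof. by rewrite vdotC vdotZl (vdotC x). Qed.

Lemma vdotNr a x : vdot a (- x) = - vdot a x.
Proof. by rewrite vdotC vdotNl (vdotC x). Qed.

Lemma vdot_sumr n (A : 'I_n -> 'rV[F]_m) x :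
  vdot x (\sum_i A i) = \sum_i vdot x (A i).
Proof. by rewrite vdotC vdot_suml; apply: eq_bigr => i _; rewrite vdotC. Qed.

Lemma vdot_deltal i x : vdot (delta_mx 0 i) x = x 0 i.
Proof.
rewrite /vdot (bigD1 i) //= big1 => [|j ne_ji]; last first.
  by rewrite mxE (negPf ne_ji) andbF mul0r.
by rewrite mxE !eqxx mul1r addr0.
Qed.

Lemma vdot_eq0 x : vdot x x <= 0 -> x = 0.
Proof.
move=> le0; apply/rowP => i; rewrite mxE.
have pos j : 0 <= x 0 j * x 0 j by rewrite -expr2 sqr_ge0.
have /eqP : vdot x x = 0 by apply/le_anti; rewrite le0 sumr_ge0.
rewrite psumr_eq0 // => /allP /(_ i (mem_index_enum i)) /=.
by rewrite mulf_eq0 orbb => /eqP.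
Qed.

(* Bartl's argument: a point [x0] refuting the implication for the last [n]
   functionals is used to project along [x0] onto the kernel of the first. *)
Lemma farkas n (A : 'I_n -> 'rV[F]_m) g :
  (forall x, (forall i, vdot (A i) x <= 0) -> vdot g x <= 0) ->
  exists2 l : 'I_n -> F, forall i, 0 <= l i & g = \sum_i l i *: A i.
Proof.
elim: n A g => [|n IH] A g Ag.
  exists (fun=> 0) => //; rewrite big_ord0; apply: vdot_eq0; apply: Ag.
  by case.
pose A' i := A (lift ord0 i).
have [A'g|] := pselect (forall x, (forall i, vdot (A' i) x <= 0) -> vdot g x <= 0).
  have [l l0 ->] := IH _ _ A'g.
  exists (fun i => if unlift ord0 i is Some j then l j else 0).
    by move=> i; case: unliftP.
  rewrite big_ord_recl unlift_none scale0r add0r.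
  by apply: eq_bigr => i _; rewrite liftK.
move=> /existsNP [x1 /not_implyP [A'x1 /negP]]; rewrite -ltNge => gx1.
have Ax1 : 0 < vdot (A ord0) x1.
  rewrite ltNge; apply/negP => le0; suff: vdot g x1 <= 0 by rewrite leNgt gx1.
  by apply: Ag => i; case: (unliftP ord0 i) => [j ->|->] //; apply: A'x1.
pose x0 := (vdot (A ord0) x1)^-1 *: x1.
have Ax0 : vdot (A ord0) x0 = 1 by rewrite vdotZr mulVf ?gt_eqF.
have gx0 : 0 < vdot g x0 by rewrite vdotZr mulr_gt0 ?invr_gt0.
have A'x0 i : vdot (A' i) x0 <= 0.
  by rewrite vdotZr mulr_ge0_le0 ?invr_ge0 ?(ltW Ax1).
move: x0 Ax0 gx0 A'x0 => x0 Ax0 gx0 A'x0.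
have [l l0 gE] : exists2 l : 'I_n -> F, forall i, 0 <= l i &
    g - vdot g x0 *: A ord0 = \sum_i l i *: (A' i - vdot (A' i) x0 *: A ord0).
  apply: IH => x A'x.
  have -> : vdot (g - vdot g x0 *: A ord0) x = vdot g (x - vdot (A ord0) x *: x0).
    by rewrite vdotDl vdotDr vdotNl vdotNr vdotZl vdotZr; ring.
  apply: Ag => i; case: (unliftP ord0 i) => [j ->|->].
    have := A'x j; rewrite vdotDl vdotNl vdotZl vdotDr vdotNr vdotZr.
    by rewrite (mulrC (vdot (A ord0) x)).
  by rewrite vdotDr vdotNr vdotZr Ax0 mulr1 subrr.
(* Coefficient of [A ord0] after expanding: [vdot g x0 - S], nonnegative since [g] is positive at
   [x0] and each [A' i] is nonpositive there. *)
pose S := \sum_i l i * vdot (A' i) x0.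
exists (fun i => if unlift ord0 i is Some j then l j else vdot g x0 - S).
  move=> i; case: unliftP => // _; rewrite subr_ge0.
  apply: le_trans (ltW gx0); rewrite -oppr_ge0 -sumrN sumr_ge0 // => j _.
  by rewrite -mulrN mulr_ge0 // oppr_ge0.
rewrite big_ord_recl unlift_none.
under eq_bigr => i _ do rewrite liftK.
move/eqP: gE; rewrite subr_eq => /eqP {1}->.
rewrite scalerBl addrC -addrA; congr (_ + _).
rewrite /S scaler_suml addrC -sumrB; apply: eq_bigr => i _.
by rewrite scalerBr scalerA.
Qed.
End Dot.

Arguments vdot {F m} a x.

(** * Sublinear functions, directional derivatives, integral minorants *)

Section Sublinear.
Variables (R : realType) (m : nat).
Implicit Types (rho : 'rV[R]_m -> R) (a v : 'rV[R]_m).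

Definition sublinear rho : Prop :=
  (forall a b, rho (a + b) <= rho a + rho b) /\
  (forall l a, 0 <= l -> rho (l *: a) = l * rho a).

(* For the support function of a convex set [K] this says that [K] is contained
   in the hull of its parts [x_i <= z] and [z + 1 <= x_i]. *)
Definition split_stable rho : Prop :=
  forall (i : 'I_m) (z : int) a (x : R),
    rho (a - delta_mx 0 i) + z%:~R <= x ->
    rho (a + delta_mx 0 i) - (z%:~R + 1) <= x -> rho a <= x.

(** The one-sided directional derivative of [rho] at [a] along [v]: for sublinear [rho] and
    [t = 1/h] the term is [(rho (a + h v) - rho a) / h]. *)
Definition dirder rho a v : R :=
  inf [set rho (t *: a + v) - t * rho a | t in [set t : R | 0 <= t]].

Lemma sublinear0 rho : sublinear rho -> rho 0 = 0.
Proof. by case=> _ hom; rewrite -(scale0r 0) hom // mul0r. Qed.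

Lemma sublinear_oppr rho a : sublinear rho -> 0 <= rho a + rho (- a).
Proof.
move=> sub; have [add _] := sub.
by rewrite -(sublinear0 _ sub) -(subrr a) add.
Qed.

(** Subadditivity on [t' a + v = (t' - t) a + (t a + v)]; the infimum in [dirder] is thus a limit
    for large [t]. *)
Lemma dirder_mono rho a v (t t' : R) : sublinear rho -> t <= t' ->
  rho (t' *: a + v) - t' * rho a <= rho (t *: a + v) - t * rho a.
Proof.
move=> [add hom] tt'; have := add ((t' - t) *: a) (t *: a + v).
by rewrite hom ?subr_ge0 // addrA -scalerDl subrK; lra.
Qed.

Lemma dirder_has_inf rho a v : sublinear rho ->
  has_inf [set rho (t *: a + v) - t * rho a | t in [set t : R | 0 <= t]].
Proof.
move=> sub; have [add hom] := sub; split.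
  by exists (rho (0 *: a + v) - 0 * rho a); exists 0 => /=.
exists (- rho (- v)) => _ [t /= t0 <-].
by have := add (t *: a + v) (- v); rewrite addrK hom //; lra.
Qed.

Lemma dirder_le rho a v (t : R) : sublinear rho -> 0 <= t ->
  dirder rho a v <= rho (t *: a + v) - t * rho a.
Proof.
move=> sub t0; apply: ge_inf; first by case: (dirder_has_inf rho a v sub).
by exists t.
Qed.

Lemma dirder_ge rho a v x :
  (forall t, 0 <= t -> x <= rho (t *: a + v) - t * rho a) -> x <= dirder rho a v.
Proof.
move=> H; apply: lb_le_inf; last by move=> _ [t /= t0 <-]; apply: H.
by exists (rho (0 *: a + v) - 0 * rho a); exists 0 => /=.
Qed.

Lemma dirder_lt rho a v x : sublinear rho -> dirder rho a v < x ->
  exists2 t, 0 <= t & forall t', t <= t' -> rho (t' *: a + v) - t' * rho a < x.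
Proof.
move=> sub lt; have [ne _] := dirder_has_inf rho a v sub.
have [_ [t /= t0 <-] tx] := inf_lt ne lt.
by exists t => // t' tt'; apply: le_lt_trans tx; apply: dirder_mono.
Qed.

Lemma dirder_le_self rho a v : sublinear rho -> dirder rho a v <= rho v.
Proof.
by move=> sub; have := dirder_le rho a v 0 sub (lexx _); rewrite scale0r add0r mul0r subr0.
Qed.

Lemma dirder_dir rho a : sublinear rho -> dirder rho a (- a) <= - rho a.
Proof.
move=> sub; have := dirder_le rho a (- a) 1 sub ler01.
by rewrite scale1r subrr sublinear0 // mul1r add0r.
Qed.

Lemma dirder_sublinear rho a : sublinear rho -> sublinear (dirder rho a).
Proof.
move=> sub; have [add hom] := sub.
have homle l v : 0 < l -> dirder rho a (l *: v) <= l * dirder rho a v.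
  move=> l0; rewrite mulrC -ler_pdivrMr //; apply: dirder_ge => t t0.
  rewrite ler_pdivrMr //; apply: le_trans (dirder_le _ _ _ (l * t) sub _) _.
    by rewrite mulr_ge0 // ltW.
  rewrite -scalerA -scalerDr hom; last exact: ltW.
  by lra.
split=> [v w|l v].
  rewrite -lerBlDr; apply: dirder_ge => t t0; rewrite lerBlDr [leRHS]addrC -lerBlDr.
  apply: dirder_ge => t' t'0; rewrite lerBlDr.
  apply: le_trans (dirder_le _ _ _ (t' + t) sub _) _; first exact: addr_ge0.
  by have := add (t' *: a + w) (t *: a + v); rewrite scalerDl addrACA (addrC w); lra.
rewrite le_eqVlt => /predU1P[<-|l0].
  rewrite scale0r mul0r; apply/le_anti/andP; split.
    by rewrite -(sublinear0 _ sub) dirder_le_self.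
  by apply: dirder_ge => t t0; rewrite addr0 hom // subrr.
apply/le_anti/andP; split; first exact: homle.
have l1 : 0 < l^-1 by rewrite invr_gt0.
have := homle _ (l *: v) l1; rewrite scalerA mulVf ?gt_eqF // scale1r.
by rewrite mulrC ler_pdivlMr // mulrC.
Qed.

(** Otherwise, at a common large [T], stability of [rho] at [T a + v] would push the term for [v]
    below its infimum. *)
Lemma dirder_split_stable rho a :
  sublinear rho -> split_stable rho -> split_stable (dirder rho a).
Proof.
move=> sub st i z v x lx rx; rewrite leNgt; apply/negP => xlt.
have [|t t0 Ht] := dirder_lt rho a (v - delta_mx 0 i) (dirder rho a v - z%:~R) sub.
  by lra.
have [|t' t'0 Ht'] := dirder_lt rho a (v + delta_mx 0 i) (dirder rho a v + (z%:~R + 1)) sub.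
  by lra.
pose T := Num.max t t'.
have T0 : 0 <= T by rewrite le_max t0.
have := Ht T; rewrite le_max lexx => /(_ isT) HT.
have := Ht' T; rewrite le_max lexx orbT => /(_ isT) HT'.
have DT := dirder_le rho a v T sub T0.
pose y := Num.max (rho (T *: a + v - delta_mx 0 i) + z%:~R)
                  (rho (T *: a + v + delta_mx 0 i) - (z%:~R + 1)).
have : rho (T *: a + v) <= y by apply: (st i z); rewrite le_max lexx ?orbT.
apply/negP; rewrite -ltNge /y gt_max -![T *: a + v + _]addrA.
by apply/andP; split; lra.
Qed.

(* Taking directional derivatives along the directions [v, e_1, ..., e_m]
   selects a lexicographically extreme point of the subdifferential. *)
Lemma split_stable_minorant rho v : sublinear rho -> split_stable rho ->
  exists y : 'rV[R]_m,
    [/\ int_vec y, forall a, vdot a y <= rho a & vdot v y = rho v].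
Proof.
move=> sub st.
(* Linearity along [d], stated as [r' d + r' (- d) <= 0], survives later derivatives because
   [dirder] only lowers the function. *)
have [r' [sub' st' le' lin']] : exists r', [/\ sublinear r', split_stable r',
    forall a, r' a <= dirder rho v a &
    forall d, d \in [seq delta_mx 0 i | i <- enum 'I_m] -> r' d + r' (- d) <= 0].
  elim: [seq _ | _ <- _] => [|d s [r' [sub' st' le' lin']]].
    exists (dirder rho v); split=> //.
      exact: dirder_sublinear.
    exact: dirder_split_stable.
  exists (dirder r' d); split.
  - exact: dirder_sublinear.
  - exact: dirder_split_stable.
  - by move=> a; apply: le_trans (le' a); apply: dirder_le_self.
  - move=> b; rewrite inE => /predU1P[->|/lin' H].
      by have := dirder_dir r' d sub'; have := dirder_le_self r' d d sub'; lra.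
    by have := dirder_le_self r' d b sub'; have := dirder_le_self r' d (- b) sub'; lra.
have [add hom] := sub'.
pose y : 'rV[R]_m := \row_i r' (delta_mx 0 i).
have ry a : r' a <= vdot a y.
  rewrite {1}(row_sum_delta a).
  have H (n : nat) (A : 'I_n -> 'rV[R]_m) : r' (\sum_i A i) <= \sum_i r' (A i).
    elim: n A => [|n IH] A; first by rewrite !big_ord0 sublinear0.
    by rewrite !big_ord_recl (le_trans (add _ _)) // lerD2l IH.
  apply: le_trans (H _ _) _; apply: ler_sum => i _; rewrite mxE.
  have := lin' (delta_mx 0 i) (map_f _ (mem_enum _ i)) => lin.
  case: (leP 0 (a 0 i)) => ai; first by rewrite hom.
  rewrite -[a 0 i *: _]opprK -scaleNr -scalerN hom; last by rewrite oppr_ge0 ltW.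
  by nra.
have yE a : vdot a y = r' a.
  apply/le_anti; rewrite ry andbT.
  by have := ry (- a); rewrite vdotNl; have := sublinear_oppr r' a sub'; lra.
exists y; split.
- move=> i; exists (Num.floor (y 0 i)).
  have yi : y 0 i = r' (delta_mx 0 i) by rewrite mxE.
  have yi' : r' (- delta_mx 0 i) = - y 0 i by rewrite -yE vdotNl vdot_deltal.
  have /andP[fl fg] := real_floor_itv (num_real (y 0 i)).
  apply/eqP; rewrite eq_le fl andbT leNgt; apply/negP => lt.
  pose z := Num.floor (y 0 i).
  (* Were [y 0 i] strictly between [z] and [z + 1], stability at [0] would make [r' 0] negative. *)
  have : r' 0 <= Num.max (z%:~R - y 0 i) (y 0 i - (z%:~R + 1)).
    by apply: (st' i z); rewrite add0r ?yi' -?yi le_max ?[- _ + _]addrC lexx ?orbT.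
  apply/negP; rewrite -ltNge sublinear0 // gt_max.
  by move: fg; rewrite intrD mulr1z => fg; apply/andP; split; rewrite /z; lra.
- by move=> a; rewrite yE (le_trans (le' a)) // dirder_le_self.
- apply/le_anti/andP; split.
    by rewrite yE (le_trans (le' v)) // dirder_le_self.
  rewrite yE; have := sublinear_oppr r' v sub'; have := le' (- v).
  by have := dirder_dir rho v sub; lra.
Qed.
End Sublinear.

Arguments sublinear {R m} rho.
Arguments split_stable {R m} rho.
Arguments split_stable_minorant {R m rho} v.

(** * Rational polytopes and their integer points *)

Lemma rat_row_denominator (m : nat) (x : 'rV[rat]_m) :
  exists (d : rat) (z : 'I_m -> int), 0 < d /\ forall i, d * x 0 i = (z i)%:~R.
Proof.
exists (\prod_i (denq (x 0 i))%:~R).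
exists (fun i => numq (x 0 i) * \prod_(j | j != i) denq (x 0 j)); split.
  by apply: prodr_gt0 => i _; rewrite ltr0z denq_gt0.
move=> i; rewrite intrM (bigD1 i) //= numqE mulrAC (mulrC (denq _)%:~R).
congr (_ * _); rewrite (big_morph _ (intrM _) (erefl 1%:~R)).
by apply: eq_bigr.
Qed.

Section Polytope.
Variables (R : realType) (m : nat).
Implicit Types (c x y : 'rV[R]_m) (W : seq 'rV[R]_m).

Definition zrow (p : 'I_m -> int) : 'rV[R]_m := \row_i (p i)%:~R.

Lemma dotzE p x : dotz p x = vdot (zrow p) x.
Proof. by apply: eq_bigr => i _; rewrite mxE. Qed.

Lemma dotrE c x : dotr c x = vdot c x.
Proof. by []. Qed.

Lemma vdot_zrow_int p x : int_vec x -> exists z : int, vdot (zrow p) x = z%:~R.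
Proof.
move=> /choice[z xz]; exists (\sum_i p i * z i).
rewrite /vdot (big_morph _ (intrD _) (erefl 0%:~R)).
by apply: eq_bigr => i _; rewrite mxE xz intrM.
Qed.

Lemma int_vec_rat x : int_vec x -> rat_vec x.
Proof. by move=> H i; have [z ->] := H i; exists z%:~R; rewrite ratr_int. Qed.

Lemma rat_vecB x y : rat_vec x -> rat_vec y -> rat_vec (x - y).
Proof.
move=> X Y i; have [q xq] := X i; have [q' yq] := Y i.
by exists (q - q'); rewrite !mxE xq yq rmorphB.
Qed.

(* If no rational functional is nonpositive on the vectors, Farkas' lemma over
   the rationals writes each [e_j] and [- e_j] as a nonnegative combination. *)
Lemma integral_normal W : (forall a, a \in W -> rat_vec a) ->
  (exists2 p : 'I_m -> int, zrow p <> 0 & forall a, a \in W -> vdot (zrow p) a <= 0)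
  \/ (forall c, (forall a, a \in W -> vdot c a <= 0) -> c = 0).
Proof.
move=> ratW.
have /choice[Q WQ] : forall i : 'I_(size W), exists q, W`_i = map_mx ratr q.
  move=> i.
  have /choice[q qE] := ratW _ (mem_nth 0 (ltn_ord i)).
  by exists (\row_j q j); apply/rowP => j; rewrite !mxE.
have vdotQ (i : 'I_(size W)) (c : 'rV[rat]_m) : 
    vdot (map_mx ratr c) W`_i = ratr (vdot (Q i) c) :> R.
  rewrite WQ vdotC /vdot rmorph_sum; apply: eq_bigr => j _.
  by rewrite !mxE rmorphM.
have [[c c0 cQ]|noc] := pselect (exists2 c : 'rV[rat]_m, c <> 0 &
    forall i, vdot (Q i) c <= 0).
  left; have [d [z [d0 dz]]] := rat_row_denominator m c.
  have zE : zrow z = ratr d *: map_mx ratr c.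
    by apply/rowP => i; rewrite !mxE -rmorphM /= dz ratr_int.
  exists z.
    move=> z0; apply: c0; apply/rowP => i; rewrite mxE.
    have := dz i; have : zrow z 0 i = 0 by rewrite z0 mxE.
    rewrite mxE => /eqP; rewrite intr_eq0 => /eqP -> /eqP.
    by rewrite mulf_eq0 gt_eqF //= => /eqP.
  move=> a /(nthP 0)[i iW <-]; rewrite zE vdotZl pmulr_rle0 ?ltr0q //.
  by rewrite (vdotQ (Ordinal iW)) lerq0 cQ.
right=> c cW.
have key (g : 'rV[rat]_m) : vdot c (map_mx ratr g) <= 0.
  have [|l l0 ->] := @farkas rat m _ Q g.
    move=> x Qx; have -> : x = 0 by apply: contrapT => x0; apply: noc; exists x.
    by rewrite vdotC vdot0l.
  rewrite raddf_sum vdot_sumr /=.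
  rewrite -oppr_ge0 -sumrN sumr_ge0 // => i _; rewrite map_mxZ vdotZr -WQ.
  by rewrite -mulrN mulr_ge0 ?ler0q // oppr_ge0 cW // mem_nth.
apply/rowP => i; rewrite mxE; apply/le_anti/andP; split.
  by have := key (delta_mx 0 i); rewrite map_delta_mx vdotC vdot_deltal.
have := key (- delta_mx 0 i); rewrite map_mxN map_delta_mx vdotC vdotNl vdot_deltal.
by rewrite oppr_le0.
Qed.

Lemma conv_vdot_le (S : set 'rV[R]_m) c (d : R) x :
  (forall y, S y -> vdot c y <= d) -> conv S x -> vdot c x <= d.
Proof.
move=> H [n [l [q [Sq [l0 [l1 ->]]]]]]; rewrite vdot_sumr -[d]mul1r -l1 mulr_suml.
by apply: ler_sum => i _; rewrite vdotZr ler_wpM2l // H.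
Qed.

Section Generators.
Variables (n : nat) (v : 'I_n -> 'rV[R]_m).
Let L := conv [set x | exists i, x = v i].

Lemma polytope_valid c (d : R) x :
  (forall i, vdot c (v i) <= d) -> L x -> vdot c x <= d.
Proof. by move=> cd; apply: conv_vdot_le => _ [i ->]. Qed.

Lemma polytope_vertex i : L (v i).
Proof.
exists 1%N, (fun=> 1), (fun=> v i); split; first by move=> _; exists i.
by rewrite !big_ord1 scale1r; split.
Qed.

(** Farkas' lemma for points lifted by a last coordinate [1], which forces the coefficients to sum
    to [1]. *)
Lemma polytope_separation y :
  (forall c (d : R), (forall i, vdot c (v i) <= d) -> vdot c y <= d) -> L y.
Proof.
move=> H; pose hom (x : 'rV[R]_m) : 'rV[R]_(m + 1) := row_mx x 1%:M.
have homE x z : vdot (hom x) z = vdot (lsubmx z) x + rsubmx z 0 0.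
  rewrite /vdot big_split_ord big_ord1 /=; congr (_ + _).
    by apply: eq_bigr => i _; rewrite row_mxEl mxE mulrC.
  by rewrite row_mxEr !mxE eqxx mul1r.
have [z Hz|l l0 yE] := @farkas R _ n (fun i => hom (v i)) (hom y).
  rewrite homE -[X in _ + X]opprK subr_le0; apply: H => i.
  by rewrite -subr_le0 opprK -homE.
exists n, l, v; split; first by move=> i; exists i.
split=> //; split.
  have := congr1 (fun z : 'rV[R]_(m + 1) => rsubmx z 0 0) yE.
  rewrite row_mxKr linear_sum summxE mxE eqxx mulr1n => ->.
  by apply: eq_bigr => i _; rewrite linearZ /= row_mxKr !mxE eqxx mulr1.
have := congr1 (fun z : 'rV[R]_(m + 1) => lsubmx z) yE.
rewrite row_mxKl linear_sum => ->.
by apply: eq_bigr => i _; rewrite linearZ /= row_mxKl.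
Qed.

Lemma polytope_conv x : conv L x -> L x.
Proof.
move=> cx; apply: polytope_separation => c d cd.
by apply: conv_vdot_le cx => y; apply: polytope_valid.
Qed.

Lemma polytope_bounded c : exists2 d : R, 0 <= d & forall x, L x -> vdot c x <= d.
Proof.
exists (\sum_i `|vdot c (v i)|); first by rewrite sumr_ge0.
move=> x; apply: polytope_valid => i.
by rewrite (bigD1 i) //= (le_trans (ler_norm _)) // lerDl sumr_ge0.
Qed.

(** By Farkas' lemma the [v i - y] generate the whole space as a cone. So every coordinate of a
    normal [c] is bounded by a fixed multiple of the slack [d - vdot c y], and a small box around
    [y] satisfies all valid inequalities. *)
Lemma polytope_interior y :
  (forall c, (forall i, vdot c (v i - y) <= 0) -> c = 0) -> L y -> interior_pt L y.
Proof.
move=> H Ly.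
have span g : exists2 l : R, 0 <= l & forall c (d : R),
    (forall i, vdot c (v i) <= d) -> vdot c g <= l * (d - vdot c y).
  have [x Hx|l l0 gE] := @farkas R m n (fun i => v i - y) g.
    have -> : x = 0 by apply: H => i; rewrite vdotC.
    by rewrite vdotC vdot0l.
  exists (\sum_i l i); first exact: sumr_ge0.
  move=> c d cd; rewrite gE vdot_sumr mulr_suml; apply: ler_sum => i _.
  by rewrite vdotZr ler_wpM2l // vdotDr vdotNr lerD2r.
have /choice[l lE] : forall j, exists l : R, 0 <= l /\ forall c (d : R),
    (forall i, vdot c (v i) <= d) -> `|c 0 j| <= l * (d - vdot c y).
  move=> j; have [l l0 lE] := span (delta_mx 0 j).
  have [l' l'0 lE'] := span (- delta_mx 0 j).
  exists (l + l'); split=> [|c d cd]; first exact: addr_ge0.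
  have := lE c d cd; have := lE' c d cd; rewrite vdotNr.
  rewrite (vdotC _ _ c (delta_mx 0 j)) vdot_deltal.
  have dy := polytope_valid _ _ _ cd Ly.
  by rewrite ler_norml => A B; apply/andP; split; nra.
have S0 : 0 <= \sum_j l j by apply: sumr_ge0 => j _; case: (lE j).
exists (1 + \sum_j l j)^-1; first by rewrite invr_gt0; lra.
move=> z yz; apply: polytope_separation => c d cd.
have -> : z = y + (z - y) by rewrite addrC subrK.
have cy : 0 <= d - vdot c y by rewrite subr_ge0; apply: polytope_valid cd Ly.
rewrite vdotDr -lerBrDl.
apply: (@le_trans _ _ (\sum_j l j * (d - vdot c y) * (1 + \sum_j l j)^-1)).
  apply: ler_sum => j _; apply: le_trans (ler_norm _) _; rewrite normrM.
  apply: ler_pM => //; first by case: (lE j) => _; apply.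
  by rewrite !mxE ltW.
rewrite -mulr_suml -mulr_suml ler_pdivrMr; last by lra.
by nra.
Qed.

Lemma polytope_int_finite :
  exists s : seq 'rV[R]_m, forall x, L x -> int_vec x -> x \in s.
Proof.
have /choice[d dE] : forall i : 'I_m, exists d : R,
    0 <= d /\ forall x, L x -> `|x 0 i| <= d.
  move=> i; have [d d0 dE] := polytope_bounded (delta_mx 0 i).
  have [d' d'0 dE'] := polytope_bounded (- delta_mx 0 i).
  exists (d + d'); split=> [|x Lx]; first exact: addr_ge0.
  have := dE x Lx; have := dE' x Lx; rewrite vdotNl vdot_deltal => A B.
  by rewrite ler_norml; apply/andP; split; lra.
pose N := Num.bound (\sum_i d i).
have dN i : d i < N%:R.
  apply: le_lt_trans (archi_boundP _); last by apply: sumr_ge0 => j _; case: (dE j).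
  by rewrite (bigD1 i) //= lerDl sumr_ge0 // => j _; case: (dE j).
exists [seq \row_i ((g i : nat)%:R - N%:R) | g : {ffun 'I_m -> 'I_(N + N).+1}].
move=> x Lx /choice[z xz].
have zN i : (`|z i| < N)%N.
  have := le_lt_trans ((dE i).2 x Lx) (dN i).
  by rewrite xz -intr_norm -[N%:R]/(N%:~R) ltr_int; case: (z i).
have zN0 i : 0 <= z i + N%:Z by move: (zN i); case: (z i) => // k; rewrite NegzE; lia.
apply/mapP; exists [ffun i => inord (absz (z i + N%:Z)%R)]; first by rewrite mem_enum.
apply/rowP => i; rewrite mxE ffunE inordK; last by move: (zN i); lia.
by rewrite xz (pmulrn _ (absz _)) gez0_abs // intrD -pmulrn addrK.
Qed.
End Generators.
End Polytope.

Arguments zrow {R m} p.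
Arguments vdot_zrow_int {R m} p {x}.
Arguments integral_normal {R m} W.
Arguments polytope_valid {R m n v c d x}.
Arguments polytope_bounded {R m n} v c.
Arguments polytope_int_finite {R m n} v.

(** * Inequalities provable by splits, and their tangent cone *)

Section Provable.
Variables (R : realType) (m k : nat).
Variables (Q : set ('rV[R]_m * 'rV[R]_k)) (w : 'I_k -> R).
Implicit Types (g : 'rV[R]_m) (d : R) (pi : 'I_m -> int).

Definition valid_ineq (S : set ('rV[R]_m * 'rV[R]_k)) g d : Prop :=
  forall p, S p -> 1 - \sum_j w j * p.2 0 j <= vdot g p.1 + d.

Definition provable g d : Prop :=
  exists t, valid_ineq (split_closure_rank t Q) g d.

Lemma valid_ineq_conv S g d : valid_ineq S g d -> valid_ineq (conv S) g d.
Proof.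
move=> V _ [n [l [q [Sq [l0 [l1 ->]]]]]].
have q1 : (\sum_i l i *: q i).1 = \sum_i l i *: (q i).1.
  by apply: (big_morph fst (op1 := +%R) (id1 := 0)).
have q2 j : (\sum_i l i *: q i).2 0 j = \sum_i l i * (q i).2 0 j.
  rewrite (big_morph snd (op1 := +%R) (id1 := 0)) // summxE.
  by apply: eq_bigr => i _; rewrite mxE.
rewrite q1 vdot_sumr -[X in X - _]l1 -[d]mul1r -[X in _ <= _ + X * _]l1 mulr_suml.
under [\sum_(j < k) _]eq_bigr => j _ do rewrite q2 mulr_sumr.
rewrite exchange_big -sumrB -big_split /=; apply: ler_sum => i _.
rewrite vdotZr -mulrDr; apply: le_trans (ler_wpM2l (l0 i) (V _ (Sq i))).
rewrite mulrBr mulr1 lerD2l lerN2 mulr_sumr le_eqVlt; apply/orP; left; apply/eqP.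
by apply: eq_bigr => j _; rewrite mulrCA.
Qed.

Lemma valid_ineq_split_closure S g d pi (pi0 : int) :
  valid_ineq (S `&` [set p | dotz pi p.1 <= pi0%:~R]) g d ->
  valid_ineq (S `&` [set p | pi0%:~R + 1 <= dotz pi p.1]) g d ->
  valid_ineq (split_closure S) g d.
Proof.
move=> V1 V2 p /(_ pi pi0); apply: valid_ineq_conv => q.
by case; [apply: V1|apply: V2].
Qed.

(** Validity passes to both sides of any split; the zero split is an arbitrary choice. Proofs of
    different ranks can thus be brought to a common rank. *)
Lemma valid_ineq_rankS t t' g d : (t <= t')%N ->
  valid_ineq (split_closure_rank t Q) g d -> valid_ineq (split_closure_rank t' Q) g d.
Proof.
move=> /subnK <-; elim: (t' - t)%N => //= n IH V.
by apply: (@valid_ineq_split_closure _ g d (fun=> 0) 0) => p [] /(IH V).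
Qed.

(** On each side of the split the correction term is nonpositive, so one further closure proves
    [g]. *)
Lemma provable_split g d pi (pi0 : int) (e e' : R) : 0 <= e -> 0 <= e' ->
  provable (g + e *: zrow pi) (d - e * pi0%:~R) ->
  provable (g - e' *: zrow pi) (d + e' * (pi0%:~R + 1)) -> provable g d.
Proof.
move=> e0 e'0 [t1 V1] [t2 V2]; exists (maxn t1 t2).+1.
move: V1 V2 => /(@valid_ineq_rankS _ _ _ _ (leq_maxl t1 t2)) V1.
move=> /(@valid_ineq_rankS _ _ _ _ (leq_maxr t1 t2)) V2.
apply: (@valid_ineq_split_closure _ g d pi pi0) => p [].
  by move=> /V1; rewrite vdotDl vdotZl /= dotzE => H E; apply: le_trans H _; nra.
by move=> /V2; rewrite vdotDl vdotNl vdotZl /= dotzE => H E; apply: le_trans H _; nra.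
Qed.

Lemma provable_convex g d g' d' (l : R) : 0 <= l <= 1 -> provable g d ->
  provable g' d' -> provable ((1 - l) *: g + l *: g') ((1 - l) * d + l * d').
Proof.
move=> /andP[l0 l1] [t1 V1] [t2 V2]; exists (maxn t1 t2).
move: V1 V2 => /(@valid_ineq_rankS _ _ _ _ (leq_maxl t1 t2)) V1.
move=> /(@valid_ineq_rankS _ _ _ _ (leq_maxr t1 t2)) V2 p Sp.
by have := V1 p Sp; have := V2 p Sp; rewrite vdotDl !vdotZl; nra.
Qed.

Lemma provable_le g d d' : d <= d' -> provable g d -> provable g d'.
Proof. by move=> dd' [t V]; exists t => p /V; lra. Qed.

(* The tangent cone, at the constant inequality [s], of the set of provable
   inequalities; [(a, b)] stands for the functional [x |-> a x + b]. *)
Definition tangent (s : R) (a : 'rV[R]_m) (b : R) : Prop :=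
  exists2 M0 : R, 0 < M0 & forall M, 0 < M <= M0 -> provable (- M *: a) (s - M * b).

Lemma tangentD s a b a' b' :
  tangent s a b -> tangent s a' b' -> tangent s (a + a') (b + b').
Proof.
(* The sum at step [x] is the midpoint of the two inequalities at step [2 x], hence the halving. *)
move=> [M M0 H] [M' M'0 H']; exists (Num.min M M' / 2).
  by rewrite divr_gt0 // lt_min M0.
move=> x /andP[x0]; rewrite ler_pdivlMr // le_min => /andP[x1 x2].
have /H A : 0 < x * 2 <= M by rewrite x1 mulr_gt0.
have /H' A' : 0 < x * 2 <= M' by rewrite x2 mulr_gt0.
have l01 : 0 <= (1 / 2 : R) <= 1 by lra.
have := provable_convex _ _ _ _ _ l01 A A'.
rewrite !scalerA.
have -> : (1 - 1 / 2) * - (x * 2) = - x by field.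
have -> : 1 / 2 * - (x * 2) = - x by field.
by rewrite -scalerDr; congr provable; field.
Qed.

Lemma tangentZ s a b (l : R) : 0 < l -> tangent s a b -> tangent s (l *: a) (l * b).
Proof.
move=> l0 [M M0 H]; exists (M / l); first by rewrite divr_gt0.
move=> x /andP[x0]; rewrite ler_pdivlMr // => xl.
by rewrite scalerA mulNr mulrA; apply: H; rewrite xl mulr_gt0.
Qed.

Lemma tangent_le s a b b' : b' <= b -> tangent s a b -> tangent s a b'.
Proof.
move=> bb' [M M0 H]; exists M => // x Hx; apply: provable_le (H x Hx).
by case/andP: Hx => x0 _; nra.
Qed.

Lemma tangent_split s a b pi (pi0 : int) (e e' : R) : 0 <= e -> 0 <= e' ->
  tangent s (a - e *: zrow pi) (b + e * pi0%:~R) ->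
  tangent s (a + e' *: zrow pi) (b - e' * (pi0%:~R + 1)) -> tangent s a b.
Proof.
move=> e0 e'0 [M M0 H] [M' M'0 H']; exists (Num.min M M'); first by rewrite lt_min M0.
move=> x /andP[x0]; rewrite le_min => /andP[x1 x2].
apply: (@provable_split _ _ pi pi0 (x * e) (x * e')).
- by rewrite mulr_ge0 // ltW.
- by rewrite mulr_ge0 // ltW.
- have := H x; rewrite x0 x1 => /(_ isT).
  by rewrite scalerBr scalerA mulNr scaleNr scaleNr opprK; congr provable; ring.
- have := H' x; rewrite x0 x2 => /(_ isT).
  by rewrite scalerDr scalerA mulNr [(- (x * e')) *: _]scaleNr; congr provable; ring.
Qed.
End Provable.

Arguments provable {R m k} Q w g d.
Arguments tangent {R m k} Q w s a b.
Arguments provable_split {R m k Q w g d} pi pi0 e e'.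
Arguments provable_convex {R m k Q w g d g' d' l}.
Arguments tangentD {R m k Q w s a b a' b'}.
Arguments tangentZ {R m k Q w s a b l}.
Arguments tangent_split {R m k Q w s a b} pi pi0 e e'.

(** * The cut of a lattice-free polytope *)

Section LCut.
Variables (R : realType) (m k : nat).
Variables (f : 'rV[R]_m) (r : 'I_k -> 'rV[R]_m).
Variables (n : nat) (v : 'I_n -> 'rV[R]_m).
Let L := conv [set x | exists i, x = v i].
Let prov := provable (Pset f r) (fun j => psi L f (r j)).
Let tang := tangent (Pset f r) (fun j => psi L f (r j)).
Hypothesis v_rat : forall i, rat_vec (v i).
Hypothesis L_free : lattice_free L.
Hypothesis f_int : interior_pt L f.
Implicit Types (a c x y : 'rV[R]_m) (d s : R).

Lemma interior_lt c d : c <> 0 -> (forall i, vdot c (v i) <= d) -> vdot c f < d.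
Proof.
move=> c0 cd; have [e e0 He] := f_int.
have cc : 0 < vdot c c.
  by rewrite ltNge; apply/negP => /vdot_eq0.
pose q := 1 + \sum_i `|c 0 i|.
have cq i : `|c 0 i| < q.
  rewrite /q (bigD1 i) //=.
  have : 0 <= \sum_(j < m | j != i) `|c 0 j| by apply: sumr_ge0.
  by lra.
have q0 : 0 < q by rewrite /q ltr_pwDl // sumr_ge0.
have : L (f + (e / q) *: c).
  apply: He => i; rewrite !mxE addrAC subrr add0r normrM.
  rewrite gtr0_norm ?divr_gt0 // -[ltRHS]mulr1 -mulrA ltr_pM2l //.
  by rewrite mulrC ltr_pdivrMr // mul1r.
move=> /(polytope_valid cd); rewrite vdotDr vdotZr.
by apply: lt_le_trans; rewrite ltrDl mulr_gt0 // divr_gt0.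
Qed.

(** Ensures that the infimum in [psi] is not the default value for the empty set. *)
Lemma psi_nonempty a : [set t : R | 0 < t /\ L (f + t^-1 *: a)] !=set0.
Proof.
have [e e0 He] := f_int.
have q0 : 0 < 1 + \sum_i `|a 0 i| by rewrite ltr_pwDl // sumr_ge0.
exists ((1 + \sum_i `|a 0 i|) / e); split; first by rewrite divr_gt0.
apply: He => i; rewrite !mxE addrAC subrr add0r invf_div normrM.
rewrite gtr0_norm ?divr_gt0 // -[ltRHS]mulr1 -mulrA ltr_pM2l // mulrC ltr_pdivrMr // mul1r.
rewrite (bigD1 i) //=.
have : 0 <= \sum_(j < m | j != i) `|a 0 j| by apply: sumr_ge0.
by lra.
Qed.

Lemma psi_ge0 a : 0 <= psi L f a.
Proof. by apply: lb_le_inf (psi_nonempty a) _ => t [/ltW]. Qed.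

Lemma psi_ge c d a : (forall i, vdot c (v i) <= d) -> vdot c f < d ->
  vdot c a <= psi L f a * (d - vdot c f).
Proof.
move=> cd cf; rewrite -ler_pdivrMr ?subr_gt0 //.
apply: lb_le_inf (psi_nonempty a) _ => t [t0 /(polytope_valid cd)].
rewrite vdotDr vdotZr ler_pdivrMr ?subr_gt0 // -lerBrDl.
by rewrite mulrC ler_pdivrMr // mulrC.
Qed.

Lemma provable_one : prov 0 1.
Proof.
exists 0%N => p [p0 _]; rewrite vdot0l add0r gerBl.
by apply: sumr_ge0 => j _; rewrite mulr_ge0 // psi_ge0.
Qed.

(** Substituting [x = f + sum_j s_j r^j] reduces this to [psi_ge] summed over the rays with weights
    [s_j]. *)
Lemma provable_supporting c d : c <> 0 -> (forall i, vdot c (v i) <= d) ->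
  prov (- (d - vdot c f)^-1 *: c) ((d - vdot c f)^-1 * d).
Proof.
move=> c0 cd; have cf := interior_lt _ _ c0 cd.
have q0 : 0 < d - vdot c f by rewrite subr_gt0.
exists 0%N => p [p0 ->]; rewrite vdotZl mulNr -mulrN -mulrDr mulrC ler_pdivlMr //.
rewrite vdotDr vdot_sumr.
suff : \sum_j vdot c (p.2 0 j *: r j) <=
    (\sum_j psi L f (r j) * p.2 0 j) * (d - vdot c f).
  by lra.
rewrite mulr_suml; apply: ler_sum => j _; rewrite vdotZr.
by rewrite mulrAC mulrC ler_wpM2r // psi_ge.
Qed.

(** Convexity allows a move from the constant towards the supporting inequality; only constants
    above [s] are assumed provable, whence the loss [e]. *)
Lemma tangent_supporting s c d (e : R) : (forall e', 0 < e' -> prov 0 (s + e')) ->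
  c <> 0 -> (forall i, vdot c (v i) <= d) -> 0 < e ->
  tang s ((d - vdot c f)^-1 *: c) (- ((d - vdot c f)^-1 * d) + s - e).
Proof.
move=> Hs c0 cd e0; exists 1 => // M /andP[M0 M1].
have M01 : 0 <= M <= 1 by rewrite M1 ltW.
have Me : 0 < M * e by rewrite mulr_gt0.
have := provable_convex M01 (Hs _ Me) (provable_supporting _ _ c0 cd).
rewrite scaler0 add0r scalerA mulrN scalerA mulNr.
by apply: provable_le; nra.
Qed.

(** * Tangent functionals when [0] is not provable *)

Section Contradiction.
Hypothesis not_prov : ~ prov 0 0.

Lemma provable_const_gt0 d : prov 0 d -> 0 < d.
Proof.
by move=> P; rewrite ltNge; apply/negP => d0; apply: not_prov; apply: provable_le d0 P.
Qed.

Section Support.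
Variable s : R.
Hypothesis s_prov : forall e, 0 < e -> prov 0 (s + e).
Hypothesis s_inf : forall d, prov 0 d -> s <= d.

(** Reading [tang s a (- d)] as [a x <= d], this is the support function of the set where all
    tangent functionals are nonpositive. *)
Let rho a := inf [set d | tang s a (- d)].

Lemma tangent_exists a : exists d, tang s a (- d).
Proof.
have [->|a0] := pselect (a = 0).
  exists 1; exists 1 => // M /andP[M0 _]; rewrite scaler0 mulrN1 opprK.
  exact: s_prov.
have [d _ dE] := polytope_bounded v a.
have ad i : vdot a (v i) <= d by apply: dE; apply: polytope_vertex.
have q0 : 0 < d - vdot a f by rewrite subr_gt0 interior_lt.
have := tangentZ q0 (tangent_supporting s a d 1 s_prov a0 ad ltr01).
rewrite scalerA mulfV ?gt_eqF // scale1r.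
by set t := (X in tangent _ _ _ _ X) => T; exists (- t); rewrite opprK.
Qed.

Lemma tangent_const d : tang s 0 d -> d <= 0.
Proof.
move=> [M M0 /(_ M)]; rewrite M0 lexx scaler0 => /(_ isT) /s_inf.
by rewrite lerBrDr gerDl pmulr_rle0.
Qed.

Lemma tangent_const_lt0 d : d < 0 -> tang s 0 d.
Proof.
move=> d0; exists 1 => // M /andP[M0 _]; rewrite scaler0 -mulrN.
by apply: s_prov; rewrite mulr_gt0 // oppr_gt0.
Qed.

Lemma rho_has_inf a : has_inf [set d | tang s a (- d)].
Proof.
split; first by have [d] := tangent_exists a; exists d.
have [d' T'] := tangent_exists (- a); exists (- d') => d /= T.
have := tangentD T T'; rewrite subrr => /tangent_const.
by lra.
Qed.

Lemma rho_le a d : tang s a (- d) -> rho a <= d.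
Proof. by move=> T; apply: ge_inf => //; case: (rho_has_inf a). Qed.

Lemma rho_lt a d : rho a < d -> tang s a (- d).
Proof.
move=> H; have [ne _] := rho_has_inf a.
have [d' T d'd] := inf_lt ne H.
by apply: tangent_le T; rewrite lerN2 ltW.
Qed.

(** The cone rules for [tang], with slack [e] because the infimum need not be attained. *)
Lemma rho_sublinear : sublinear rho.
Proof.
have homle l a : 0 < l -> rho (l *: a) <= l * rho a.
  move=> l0; rewrite -ler_pdivrMl //; apply/ler_addgt0Pr => e e0.
  rewrite ler_pdivrMl //; apply: rho_le; rewrite -mulrN; apply: tangentZ => //.
  by apply: rho_lt; rewrite ltrDl.
split=> [a b|l a].
  apply/ler_addgt0Pr => e e0; apply: rho_le.
  have e2 : 0 < e / 2 by rewrite divr_gt0.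
  have -> : - (rho a + rho b + e) = - (rho a + e / 2) + - (rho b + e / 2) by field.
  by apply: tangentD; apply: rho_lt; rewrite ltrDl.
rewrite le_eqVlt => /predU1P[<-|l0].
  rewrite scale0r mul0r; apply/le_anti/andP; split.
    apply/ler_addgt0Pr => e e0; apply: rho_le; apply: tangent_const_lt0; lra.
  have [ne _] := rho_has_inf 0.
  by apply: lb_le_inf ne _ => d /tangent_const; rewrite oppr_le0.
apply/le_anti/andP; split; first exact: homle.
have l1 : 0 < l^-1 by rewrite invr_gt0.
have := homle _ (l *: a) l1; rewrite scalerA mulVf ?gt_eqF // scale1r.
by rewrite mulrC ler_pdivlMr // mulrC.
Qed.

Lemma rho_split_stable : split_stable rho.
Proof.
move=> i z a x lx rx; apply/ler_addgt0Pr => e e0; apply: rho_le.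
have eE : zrow (fun j => (j == i)%:Z) = delta_mx 0 i :> 'rV[R]_m.
  by apply/rowP => j; rewrite !mxE eqxx /=; case: (j == i).
apply: (tangent_split (fun j => (j == i)%:Z) z 1 1) => //;
  rewrite eE scale1r mul1r.
  have -> : - (x + e) + z%:~R = - (x + e - z%:~R) by ring.
  by apply: rho_lt; lra.
have -> : - (x + e) - (z%:~R + 1) = - (x + e + (z%:~R + 1)) by ring.
by apply: rho_lt; lra.
Qed.
End Support.

(* The extreme point [y] produced by the support function of the tangent cone is
   an integral point of [L]; since it is not interior, the infimum [s] of the
   provable constants is [0]. *)
Lemma tangent_strict a d :
  (forall x, L x -> int_vec x -> vdot a x + d < 0) -> tang 0 a d.
Proof.
move=> ad; pose s := inf [set d | prov 0 d].
have lb0 : lbound [set d | prov 0 d] 0 by move=> x /provable_const_gt0/ltW.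
have ne : [set d | prov 0 d] !=set0 by exists 1; apply: provable_one.
have s_prov e : 0 < e -> prov 0 (s + e).
  move=> e0; have [x P xs] : exists2 x, prov 0 x & x < s + e.
    by apply: inf_lt ne _; rewrite ltrDl.
  exact: provable_le (ltW xs) P.
have s_inf (x : R) : prov 0 x -> s <= x by apply: ge_inf; exists 0.
have s0 : 0 <= s by apply: lb_le_inf.
pose rho a := inf [set d | tang s a (- d)].
have [y [yint ymin ya]] := split_stable_minorant (rho := rho) a
  (rho_sublinear s s_prov s_inf) (rho_split_stable s s_prov s_inf).
(* [y] satisfies each supporting inequality with slack [s (x - vdot c f)], so a positive [s] would
   make it interior. *)
have supp c (x : R) : c <> 0 -> (forall i, vdot c (v i) <= x) ->
    vdot c y <= x - s * (x - vdot c f).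
  move=> c0 cx; have := interior_lt _ _ c0 cx; rewrite -subr_gt0 => q0.
  suff : (x - vdot c f)^-1 * vdot c y <= (x - vdot c f)^-1 * x - s.
    rewrite -(ler_pM2l q0) mulrBr !mulrA mulfV ?gt_eqF // !mul1r.
    by rewrite [s * _]mulrC.
  rewrite -vdotZl; apply: le_trans (ymin _) _; apply/ler_addgt0Pr => e e0.
  apply: (rho_le s s_prov s_inf).
  have := tangent_supporting s c x e s_prov c0 cx e0.
  by congr (tangent _ _ _ _ _); ring.
have Ly : L y.
  apply: polytope_separation => c x cx.
  have [c0|c0] := pselect (c = 0).
    have [e e0 /(_ f) Lf] := f_int.
    have /(polytope_valid cx) : L f.
      by apply: Lf => i; rewrite subrr normr0.
    by rewrite c0 !vdot0l.
  have := supp _ _ c0 cx; have := interior_lt _ _ c0 cx.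
  by nra.
have s_eq0 : s = 0.
  apply/le_anti; rewrite s0 andbT leNgt; apply/negP => s_gt0.
  apply: (L_free y yint); apply: polytope_interior Ly => c cv.
  apply: contrapT => c0.
  have cx i : vdot c (v i) <= vdot c y.
    by have := cv i; rewrite vdotDr vdotNr subr_le0.
  have := supp _ _ c0 cx; have := interior_lt _ _ c0 cx.
  by nra.
rewrite -s_eq0 -[d]opprK; apply: rho_lt => //.
rewrite -/(rho a) -ya; have := ad y Ly yint; lra.
Qed.

Lemma affine_int_lt0 (p : 'I_m -> int) (b : int) x : int_vec x ->
  vdot (zrow p) x + b%:~R < 0 -> vdot (zrow p) x + b%:~R <= -1.
Proof.
move=> /(vdot_zrow_int p)[z ->]; rewrite -intrD -[-1]/((-1)%:~R) ltrz0 ler_int.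
by lia.
Qed.

Section IntegralFace.
Variables (c : 'I_m -> int) (d : int).
Hypothesis c_neq0 : zrow c <> 0 :> 'rV[R]_m.
Hypothesis c_valid : forall i, vdot (zrow c) (v i) <= d%:~R.

(** Let [w = c x - d] and split at [d - 1]. The weight [M / 2] leaves [- M (w - 1) / 2] on the lower
    side, where [w - 1 < 0] on [L]; the weight [1 / (d - c f) - M] leaves the supporting inequality
    on the upper side. *)
Lemma tangent_integral_face : tang 0 (zrow c) (- d%:~R).
Proof.
have [M0 M0_gt0 HM] : tang 0 (1 / 2 *: zrow c) (- (1 / 2 * d%:~R) - 1 / 2).
  apply: tangent_strict => x Lx _; rewrite vdotZl.
  by have := polytope_valid c_valid Lx; lra.
have q0 : 0 < d%:~R - vdot (zrow c) f by rewrite subr_gt0 interior_lt.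
exists (Num.min M0 (d%:~R - vdot (zrow c) f)^-1); first by rewrite lt_min M0_gt0 invr_gt0.
move=> M /andP[M_gt0]; rewrite le_min => /andP[M_le M_le'].
apply: (provable_split c (d - 1) (M * (1 / 2))
  ((d%:~R - vdot (zrow c) f)^-1 - M)).
- by lra.
- by rewrite subr_ge0.
- have := HM M; rewrite M_gt0 M_le => /(_ isT).
  congr (provable _ _ _ _); last by rewrite intrD; field.
  by rewrite scalerA -scalerDl; congr (_ *: _); field.
- have := provable_supporting _ _ c_neq0 c_valid; congr (provable _ _ _ _).
    by rewrite -scalerBl; congr (_ *: _); ring.
  by rewrite intrD; ring.
Qed.

(* Rounding [u - 1/2 <= 0] to [u <= 0] along the split [u <= 0 \/ 1 <= u] is
   possible modulo the functional of the face, which is itself tangent. *)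
Lemma tangent_in_integral_face (p : 'I_m -> int) (b : int) :
  (forall x, L x -> int_vec x -> vdot (zrow p) x + b%:~R <= 0) ->
  (forall x, L x -> int_vec x -> vdot (zrow p) x + b%:~R = 0 ->
     vdot (zrow c) x = d%:~R) ->
  tang 0 (zrow p) b%:~R.
Proof.
move=> u_le0 u_face.
(* With [w = c x - d], the split on [u] reduces [u + w] to [w] and to [2 u + w - 1], which is
   negative on the integer points of [L]. *)
have pc : tang 0 (zrow p + zrow c) (b%:~R - d%:~R).
  apply: (tangent_split p (- b) 1 1) => //; rewrite scale1r mul1r.
    rewrite addrAC subrr add0r intrN addrAC subrr add0r.
    exact: tangent_integral_face.
  apply: tangent_strict => x Lx xint; rewrite !vdotDl intrN.
  have := u_le0 x Lx xint; have := polytope_valid c_valid Lx.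
  by lra.
have [W W0 HW] := polytope_bounded v (- zrow c : 'rV[R]_m).
(* This gives [e (d - c x) <= 1] on [L], so [u - e (w + 1)] is negative where [u <= -1], and also
   where [u = 0], as [w = 0] there. *)
pose e : R := (1 + W + `|d%:~R|)^-1.
have q0 : 0 < 1 + W + `|d%:~R| :> R by have := normr_ge0 (d%:~R : R); lra.
have e0 : 0 < e by rewrite invr_gt0.
apply: (tangent_split c (d - 1) e 1) => //; first exact: ltW.
  apply: tangent_strict => x Lx xint; rewrite vdotDl vdotNl vdotZl.
  have [u0|u_lt0] := eqVneq (vdot (zrow p) x + b%:~R) 0.
    by rewrite (u_face x) // intrD; lra.
  have {u_lt0} : vdot (zrow p) x + b%:~R <= -1.
    by apply: affine_int_lt0 => //; rewrite lt_neqAle u_lt0 u_le0.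
  have : e * (d%:~R - vdot (zrow c) x) <= 1.
    rewrite /e mulrC ler_pdivrMr // mul1r.
    by have := HW x Lx; rewrite vdotNl; have := ler_norm (d%:~R : R); lra.
  by rewrite intrD; lra.
rewrite scale1r mul1r intrD.
by have -> : b%:~R - (d%:~R + (-1)%:~R + 1) = b%:~R - d%:~R :> R by ring.
Qed.
End IntegralFace.

(** With [c = 0] the nonempty face would be all of [L], whose dimension is larger. *)
Lemma facet_normal (G : set 'rV[R]_m) : facet L G ->
  exists c e, [/\ c <> 0, forall x, L x -> vdot c x <= e &
                 forall x, G x -> vdot c x = e].
Proof.
move=> [[c [e [cL ->]]] [t [[q [Lq q_indep]] [_ [[q' [Gq' _]] nGt]]]]].
exists c, e; split=> [c0|//|x []//].
apply: nGt; exists q; split=> // i; split=> //=.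
by have [_ /= <-] := Gq' ord0; rewrite c0 !dotrE !vdot0l.
Qed.

Hypothesis L_2hyp : two_hyperplane_property L.

(** The length of [s], a list covering the integer zeros, is the induction measure. *)
Lemma tangent_integral (s : seq 'rV[R]_m) (p : 'I_m -> int) (b : int) :
  (forall x, L x -> int_vec x -> vdot (zrow p) x + b%:~R <= 0) ->
  (forall x, L x -> int_vec x -> vdot (zrow p) x + b%:~R = 0 -> x \in s) ->
  tang 0 (zrow p) b%:~R.
Proof.
have [N] := ubnP (size s); elim: N s p b => // N IH s p b sN u_le0 u_s.
pose Z x := [/\ L x, int_vec x & vdot (zrow p) x + b%:~R = 0].
have [[y0 Zy0]|noZ] := pselect (exists y, Z y); last first.
  apply: tangent_strict => x Lx xint; rewrite lt_neqAle u_le0 // andbT.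
  by apply/eqP => u0; apply: noZ; exists x.
have [Ly0 y0int u0] := Zy0.
(* Nonpositivity on [W] means being maximal over [L] at [y0] and constant on the zeros, whose
   differences occur with both signs. *)
pose W := [seq v i - y0 | i <- enum 'I_n] ++
  ([seq y - y0 | y <- s & `[< Z y >]] ++ [seq y0 - y | y <- s & `[< Z y >]]).
have WP c : (forall a, a \in W -> vdot c a <= 0) <->
    (forall i, vdot c (v i) <= vdot c y0) /\ (forall y, Z y -> vdot c y = vdot c y0).
  split=> [cW|[cv cZ] a].
    split=> [i|y Zy].
      rewrite -subr_le0 -vdotNr -vdotDr; apply: cW.
      by rewrite mem_cat; apply/orP; left; apply/mapP; exists i; rewrite ?mem_enum.
    have ys : y \in [seq y <- s | `[< Z y >]].
      by rewrite mem_filter asboolT //=; case: Zy => *; apply: u_s.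
    have /cW : y - y0 \in W.
      by rewrite !mem_cat; apply/or3P/Or32; apply/mapP; exists y.
    have /cW : y0 - y \in W.
      by rewrite !mem_cat; apply/or3P/Or33; apply/mapP; exists y.
    by rewrite !vdotDr !vdotNr; lra.
  rewrite !mem_cat => /or3P[] /mapP[z]; last 2 first.
  - rewrite mem_filter => /andP[/asboolP/cZ cz _ ->].
    by rewrite vdotDr vdotNr cz subrr.
  - rewrite mem_filter => /andP[/asboolP/cZ cz _ ->].
    by rewrite vdotDr vdotNr cz subrr.
  by move=> _ ->; rewrite vdotDr vdotNr subr_le0.
have W_rat a : a \in W -> rat_vec a.
  have Zrat y : Z y -> rat_vec y by case=> _ /int_vec_rat.
  rewrite !mem_cat => /or3P[] /mapP[z].
  - by move=> _ ->; apply: rat_vecB => //; apply: Zrat.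
  - by rewrite mem_filter => /andP[/asboolP Zz _ ->]; apply: rat_vecB; apply: Zrat.
  - by rewrite mem_filter => /andP[/asboolP Zz _ ->]; apply: rat_vecB; apply: Zrat.
case: (integral_normal W W_rat) => [[c c0 /WP[cv cZ]]|noc].
  have [d cy0] := vdot_zrow_int c y0int.
  apply: (tangent_in_integral_face c d) => // [i|x Lx xint ux].
    by rewrite -cy0.
  by rewrite -cy0; apply: cZ.
pose F := integer_hull L `&` [set x | dotr (zrow p) x = - b%:~R].
have FZ x : (F `&` int_vec (R:=R) (m:=m)) x <-> Z x.
  split=> [[[hx ux] xint]|[Lx xint ux]].
    split=> //; last by rewrite -dotrE ux addNr.
    apply: polytope_conv; case: hx => t [l [q [Lq H]]].
    by exists t, l, q; split=> // i; case: (Lq i).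
  split=> //; split; last first.
    by rewrite /= dotrE; lra.
  exists 1%N, (fun=> 1), (fun=> x); split=> //.
  by rewrite !big_ord1 scale1r; split.
have F_face : face (integer_hull L) F.
  exists (zrow p), (- b%:~R); split=> // x hx.
  by apply: conv_vdot_le hx => y [Ly yint]; have := u_le0 y Ly yint; lra.
have F_nfacet : ~ exists G, facet L G /\ F `<=` G.
  move=> [G [/facet_normal[c [e [c0 ce cG]]] FG]]; apply: c0; apply: noc; apply/WP.
  have Ze y : Z y -> vdot c y = e by move=> /FZ[Fy _]; apply/cG/FG.
  split=> [i|y Zy]; rewrite (Ze y0) //; last exact: Ze.
  by apply: ce; apply: polytope_vertex.
have [Z1|[pi [pi0 [A [B [ABF [_ [[a0 Aa0] [[b0 Bb0] [HA HB]]]]]]]]]] :=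
  L_2hyp F F_face F_nfacet.
  (* With a single zero, [noc] makes the integer point [y0] interior to [L]. *)
  exfalso; apply: (L_free y0 y0int); apply: polytope_interior Ly0 => c cv.
  apply: noc; apply/WP; split=> [i|y Zy].
    by have := cv i; rewrite vdotDr vdotNr subr_le0.
  by congr vdot; apply: Z1; apply/FZ.
have ZAB x : Z x -> vdot (zrow pi) x = pi0%:~R \/ vdot (zrow pi) x = pi0%:~R + 1.
  by move=> /FZ; rewrite -ABF -dotzE => -[/HA|/HB]; [left|right].
have [w1 w1_ge0 w1E] := polytope_bounded v (zrow pi : 'rV[R]_m).
have [w2 w2_ge0 w2E] := polytope_bounded v (- zrow pi : 'rV[R]_m).
(* [K] exceeds [pi0 - pi x] and [pi x - pi0 - 1] on [L], so adding either to [K u] keeps it negative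
   where [u <= -1]. *)
pose K := Num.bound (w1 + w2 + `|pi0%:~R : R| + 1).
have K_gt : w1 + w2 + `|pi0%:~R : R| + 1 < K%:R.
  by apply: archi_boundP; have := normr_ge0 (pi0%:~R : R); lra.
have K_gt0 : 0 < K%:R :> R by have := normr_ge0 (pi0%:~R : R); lra.
(* The integer zeros of [K u + q x + q0] in [L] are zeros of [u] other than [t], so the induction
   hypothesis applies with [t] removed; then divide by [K]. *)
have side (q : 'I_m -> int) (q0 : int) t : Z t -> vdot (zrow q) t + q0%:~R < 0 ->
    (forall x, Z x -> vdot (zrow q) x + q0%:~R <= 0) ->
    (forall x, L x -> vdot (zrow q) x + q0%:~R < K%:R) ->
    tang 0 (zrow p + K%:R^-1 *: zrow q) (b%:~R + K%:R^-1 * q0%:~R).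
  move=> [Lt tint ut] qt qZ qK.
  have ts : t \in s by apply: u_s.
  pose p' i := K%:Z * p i + q i; pose b' := K%:Z * b + q0.
  have p'E : zrow p' = K%:R *: zrow p + zrow q :> 'rV[R]_m.
    by apply/rowP => i; rewrite !mxE intrD intrM.
  have b'E : b'%:~R = K%:R * b%:~R + q0%:~R :> R by rewrite intrD intrM.
  have u'E x : vdot (zrow p') x + b'%:~R =
      K%:R * (vdot (zrow p) x + b%:~R) + (vdot (zrow q) x + q0%:~R).
    by rewrite p'E b'E vdotDl vdotZl; ring.
  have u'_lt0 x : L x -> int_vec x -> vdot (zrow p) x + b%:~R != 0 ->
      vdot (zrow p') x + b'%:~R < 0.
    move=> Lx xint ux; have : vdot (zrow p) x + b%:~R <= -1.
      by apply: affine_int_lt0 => //; rewrite lt_neqAle ux u_le0.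
    by rewrite u'E; have := qK x Lx; nra.
  have : tang 0 (zrow p') b'%:~R.
    apply: (IH [seq x <- s | x != t]).
    - apply: (@leq_trans (size s)) => //; rewrite size_filter.
      rewrite -(count_predC (pred1 t) s) -[ltnLHS]add0n ltn_add2r.
      by rewrite -has_count has_pred1.
    - move=> x Lx xint; have [ux|ux] := eqVneq (vdot (zrow p) x + b%:~R) 0.
        by rewrite u'E ux mulr0 add0r qZ.
      by rewrite ltW // u'_lt0.
    - move=> x Lx xint u'x; have [ux|ux] := eqVneq (vdot (zrow p) x + b%:~R) 0.
        rewrite mem_filter u_s // andbT; apply/eqP => xt.
        by move: u'x qt; rewrite u'E ux mulr0 add0r xt => ->; rewrite ltxx.
      by have := u'_lt0 x Lx xint ux; rewrite u'x ltxx.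
  have Ki : 0 < (K%:R : R)^-1 by rewrite invr_gt0.
  move=> /(tangentZ Ki).
  rewrite p'E b'E scalerDr scalerA mulrDr mulrA mulVf ?gt_eqF // scale1r mul1r.
  exact.
have Za0 : Z a0 by apply/FZ; rewrite -ABF; left.
have Zb0 : Z b0 by apply/FZ; rewrite -ABF; right.
have wa0 := HA _ Aa0; have wb0 := HB _ Bb0; rewrite !dotzE in wa0 wb0.
have Ki : 0 <= (K%:R : R)^-1 by rewrite invr_ge0 ltW.
(* With [w = pi x - pi0], the sides carry [u - w / K], which loses the zero [b0], and
   [u + (w - 1) / K], which loses [a0]. *)
apply: (tangent_split pi pi0 K%:R^-1 K%:R^-1) => //.
  have zN : zrow (fun i => - pi i) = - zrow pi :> 'rV[R]_m.
    by apply/rowP => i; rewrite !mxE intrN.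
  have := side (fun i => - pi i) pi0 b0; rewrite zN scalerN; apply=> //.
  - by rewrite vdotNl wb0; lra.
  - by move=> x /ZAB; rewrite vdotNl => -[->|->]; lra.
  - by move=> x Lx; have := w2E x Lx; have := ler_norm (pi0%:~R : R); lra.
have := side pi (- (pi0 + 1)) a0; rewrite intrN intrD mulrN; apply=> //.
- by rewrite wa0; lra.
- by move=> x /ZAB[->|->]; lra.
- move=> x Lx; have := w1E x Lx; have := ler_norm (- pi0%:~R : R).
  by rewrite normrN; lra.
Qed.

End Contradiction.
End LCut.

Theorem theorem3 (R : realType) (m k : nat) (hm : (0 < m)%N) (hk : (0 < k)%N)
  (f : 'rV[R]_m) (r : 'I_k -> 'rV[R]_m) (L : set 'rV[R]_m) :
  rat_vec f -> ~ int_vec f ->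
  (forall j, rat_vec (r j) /\ r j <> 0) ->
  (exists p, Xset f r p) ->
  rational_polytope L -> lattice_free L -> interior_pt L f ->
  two_hyperplane_property L ->
  finite_split_rank (Pset f r) (fun j => psi L f (r j)).
Proof.
move=> _ _ _ _ [n [v [v_rat ->]]] {L} L_free f_int L_2hyp.
set L := conv _ in L_free f_int L_2hyp *.
suff [t cut] : provable (Pset f r) (fun j => psi L f (r j)) 0 0.
  by exists t => p /cut; rewrite vdot0l; lra.
apply: contrapT => not_prov.
have [s sE] := polytope_int_finite v.
(* For [u = 0] every integer point of [L] is a zero, and tangency at any admissible step is
   provability of [0]. *)
have [||M M0 /(_ M)] := tangent_integral R m k f r n v v_rat L_free f_int not_prov
    L_2hyp s (fun=> 0) 0.
- have -> : zrow (fun=> 0) = 0 :> 'rV[R]_m by apply/rowP => i; rewrite !mxE.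
  by move=> x _ _; rewrite vdot0l addr0.
- by move=> x Lx xint _; apply: sE.
have -> : zrow (fun=> 0) = 0 :> 'rV[R]_m by apply/rowP => i; rewrite !mxE.
by rewrite M0 lexx scaler0 mulr0 subr0 => /(_ isT).
Qed.
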